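(* Let $R$ be a commutative Noetherian ring of prime characteristic $p$. Then tight closure commutes with localization in $R$ (i.e. for every ideal $I$ of $R$ and every multiplicative system $W\subseteq R$ one has $I^*R_W=(IR_W)^*$) in each of the following cases: (i) $\dim R<2$; (ii) $R$ is a two-dimensional local ring; (iii) $\dim R=2$ and either $R$ is a Nagata ring or $R$ possesses a $q'$-weak test element for some power $q'$ of $p$.
   Context: All rings are commutative Noetherian with identity of prime characteristic $p$; $q$ denotes a nonnegative power $p^e$ of $p$. $R^{\circ}$ is the set of elements of $R$ not in any minimal prime of $R$. For an ideal $I$, $I^{[q]}$ is the ideal generated by the $q$-th powers of elements of $I$. The tight closure $I^*$ of $I$ is the set of $x\in R$ for which there is $c\in R^{\circ}$ with $cx^q\in I^{[q]}$ for all $q\gg0$; for $R_W$ the tight closure $(IR_W)^*$ is taken in the ring $R_W$. For a power $q'$ of $p$, an element $c\in R^{\circ}$ is a $q'$-weak test element if for every ideal $I$ of $R$ and every $x\in I^*$ one has $cx^q\in I^{[q]}$ for all $q\ge q'$. *)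

(* Defs.v *)
From HB Require Import structures.
From mathcomp Require Import all_boot all_order all_algebra.
Set Implicit Arguments. Unset Strict Implicit. Unset Printing Implicit Defensive.
Import Order.TTheory GRing.Theory Num.Theory.
Local Open Scope ring_scope.

Section Ideals.
Variable R : comPzRingType.

Definition subset (A B : R -> Prop) := forall x, A x -> B x.
Definition same (A B : R -> Prop) := forall x, A x <-> B x.

Definition is_ideal (I : R -> Prop) : Prop :=
  [/\ I 0, (forall x y, I x -> I y -> I (x + y)) & (forall r x, I x -> I (r * x))].

Definition gen (A : R -> Prop) (x : R) : Prop :=
  exists n (a r : 'I_n -> R), (forall i, A (a i)) /\ x = \sum_(i < n) r i * a i.

Definition frob_pow (I : R -> Prop) (q : nat) : R -> Prop :=
  gen (fun y => exists2 x, I x & y = x ^+ q).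

Definition is_prime (P : R -> Prop) : Prop :=
  [/\ is_ideal P, ~ P 1 & forall x y, P (x * y) -> P x \/ P y].

Definition is_minimal_prime (P : R -> Prop) : Prop :=
  is_prime P /\ forall Q, is_prime Q -> subset Q P -> subset P Q.

Definition is_maximal (M : R -> Prop) : Prop :=
  [/\ is_ideal M, ~ M 1 &
      forall N, is_ideal N -> ~ N 1 -> subset M N -> subset N M].

Definition circ (c : R) : Prop := forall P, is_minimal_prime P -> ~ P c.

Definition tight_closure (p : nat) (I : R -> Prop) (x : R) : Prop :=
  exists2 c, circ c &
    exists e0, forall e, (e0 <= e)%N -> frob_pow I (p ^ e) (c * x ^+ (p ^ e)).

Definition noetherian : Prop :=
  forall C : nat -> R -> Prop, (forall n, is_ideal (C n)) ->
    (forall n, subset (C n) (C n.+1)) ->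
    exists n, forall m, (n <= m)%N -> subset (C m) (C n).

Definition dim_ge (n : nat) : Prop :=
  exists P : nat -> R -> Prop,
    (forall i, (i <= n)%N -> is_prime (P i)) /\
    (forall i, (i < n)%N -> subset (P i) (P i.+1) /\ ~ subset (P i.+1) (P i)).

Definition dim_lt (n : nat) : Prop := ~ dim_ge n.
Definition dim_eq (n : nat) : Prop := dim_ge n /\ ~ dim_ge n.+1.

Definition is_local : Prop :=
  exists M, is_maximal M /\ forall N, is_maximal N -> same N M.

Definition mult_system (W : R -> Prop) : Prop :=
  W 1 /\ forall x y, W x -> W y -> W (x * y).

Definition weak_test_element (p e' : nat) (c : R) : Prop :=
  circ c /\
  forall I, is_ideal I -> forall x, tight_closure p I x ->
    forall e, (e' <= e)%N -> frob_pow I (p ^ e) (c * x ^+ (p ^ e)).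

End Ideals.

Definition img (R S : Type) (f : R -> S) (A : R -> Prop) (s : S) : Prop :=
  exists2 r, A r & s = f r.

Definition is_localization (R S : comPzRingType) (W : R -> Prop)
  (f : {rmorphism R -> S}) : Prop :=
  [/\ (forall w, W w -> exists v, f w * v = 1),
      (forall s, exists r w, W w /\ s * f w = f r) &
      (forall r, f r = 0 -> exists2 w, W w & w * r = 0)].

(* Nagata ring (Matsumura): Noetherian and R/P is N-2 for every prime P.
   R/P ranges over all domains D with a surjective ring map R -> D;
   N-2: for every field L containing Frac(D) finitely (L finite-dimensional
   over Frac(D)), the integral closure of D in L is a finite D-module. *)
Definition integral_over (D : idomainType) (L : fieldType)
  (g : {rmorphism D -> L}) (x : L) : Prop :=
  exists2 P : {poly D}, P \is monic & root (map_poly g P) x.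

Definition N2 (D : idomainType) : Prop :=
  forall (L : fieldType) (g : {rmorphism D -> L}), injective g ->
  (exists n (l : 'I_n -> L), forall x, exists (a : 'I_n -> D) (b : D),
      b != 0 /\ g b * x = \sum_(i < n) g (a i) * l i) ->
  exists m (y : 'I_m -> L), (forall j, integral_over g (y j)) /\
    forall x, integral_over g x ->
      exists c : 'I_m -> D, x = \sum_(j < m) g (c j) * y j.

Definition nagata (R : comPzRingType) : Prop :=
  noetherian R /\
  forall (D : idomainType) (f : {rmorphism R -> D}), (forall d, exists r, f r = d) -> N2 D.

(* Main.v *)
(** Modulo a minimal prime R becomes a domain D of dimension at most two, and
    one is given c x^q in I^[q] D_W for q >> 0. If Q is a nonmaximal nonzero
    prime of D, then D_Q has dimension one and an infinite residue field, so
    I D_Q has a principal reduction: there are f in I and k outside Q with k I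
    in the tight closure of (f), whence c_1 k^q I^[q] lies in (f^q) for a fixed
    nonzero c_1. As the quotients f^i D / f^(i+1) D are isomorphic to D/f, a
    single w in W satisfies w^q ((f^q) : W^oo) <= (f^q) for all q, so that
    c c_1 w^q k^q x^q lies in (f^q), hence in I^[q]. The k for which some such
    multiplier exists form a W-saturated ideal contained in no nonmaximal prime;
    it is therefore comaximal with every element of W, and the q-th power of a
    relation 1 = k + u v, with v in W multiplying c x^q into I^[q], removes k. *)

Require Import Defs.
From Stdlib Require List.
From HB Require Import structures.
From mathcomp Require Import all_boot all_order all_algebra.
From mathcomp Require Import boolp ring.
Import Defs GRing.Theory.
Set Implicit Arguments. Unset Strict Implicit. Unset Printing Implicit Defensive.
Local Open Scope ring_scope.

(** * Ideals, primes and the ascending chain condition *)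

Section IdealTheory.
Variable R : comPzRingType.
Implicit Types (A B I J P Q W : R -> Prop).

Lemma ideal0 {I} : is_ideal I -> I 0. Proof. by case. Qed.

Lemma idealD {I} x y : is_ideal I -> I x -> I y -> I (x + y).
Proof. by case=> _ + _; apply. Qed.

Lemma idealZl {I} r x : is_ideal I -> I x -> I (r * x).
Proof. by case=> _ _; apply. Qed.

Lemma idealZr {I} r x : is_ideal I -> I x -> I (x * r).
Proof. by rewrite mulrC; apply: idealZl. Qed.

Lemma idealB {I} x y : is_ideal I -> I x -> I y -> I (x - y).
Proof. by move=> hI Ix Iy; apply: idealD => //; rewrite -mulN1r; apply: idealZl. Qed.

Lemma primeNM {P} x y : is_prime P -> ~ P x -> ~ P y -> ~ P (x * y).
Proof. by case=> _ _ hM Px Py /hM[]. Qed.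

Lemma primeX {P} x n : is_prime P -> P (x ^+ n) -> P x.
Proof.
move=> [hI P1 hM]; elim: n => [|n IHn]; first by rewrite expr0 => /P1.
by rewrite exprS => /hM[].
Qed.

Lemma zero_ideal : is_ideal (fun x : R => x = 0).
Proof.
by split=> // [x y -> ->|r x ->]; rewrite ?addr0 ?mulr0.
Qed.

Lemma principal_ideal (a : R) : is_ideal (fun x => exists r, x = r * a).
Proof.
split; first by exists 0; rewrite mul0r.
- by move=> _ _ [r ->] [s ->]; exists (r + s); rewrite mulrDl.
- by move=> s _ [r ->]; exists (s * r); rewrite mulrA.
Qed.

Lemma gen_incl A : subset A (gen A).
Proof.
move=> x Ax; exists 1%N, (fun=> x), (fun=> 1); split=> //.
by rewrite big_ord1 mul1r.
Qed.

Lemma gen_ideal A : is_ideal (gen A).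
Proof.
split.
- exists 0%N, (fun=> 0), (fun=> 0); split; first by case.
  by rewrite big_ord0.
- move=> _ _ [n [a [r [Aa ->]]]] [m [b [s [Ab ->]]]].
  exists (n + m)%N,
    (fun i => match split i with inl j => a j | inr j => b j end),
    (fun i => match split i with inl j => r j | inr j => s j end).
  split; first by move=> i; case: (split i).
  rewrite big_split_ord /=; congr (_ + _); apply: eq_bigr => i _.
    by rewrite (unsplitK (inl i)).
  by rewrite (unsplitK (inr i)).
- move=> s _ [n [a [r [Aa ->]]]]; exists n, a, (fun i => s * r i).
  by split=> //; rewrite mulr_sumr; apply: eq_bigr => i _; rewrite mulrA.
Qed.

Lemma gen_min A J : is_ideal J -> subset A J -> subset (gen A) J.
Proof.
move=> hJ AJ _ [n [a [r [Aa ->]]]].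
elim/big_ind: _; first exact: ideal0.
  by move=> x y; apply: idealD.
by move=> i _; apply: idealZl => //; apply: AJ.
Qed.

Lemma frob_powX I x q : I x -> frob_pow I q (x ^+ q).
Proof. by move=> Ix; apply: gen_incl; exists x. Qed.

Definition adjoin I g (x : R) := exists t u, I t /\ x = t + u * g.

Lemma adjoin_ideal I g : is_ideal I -> is_ideal (adjoin I g).
Proof.
move=> hI; split.
- by exists 0, 0; split; [exact: ideal0 | rewrite mul0r addr0].
- move=> _ _ [t [u [It ->]]] [t' [u' [It' ->]]].
  exists (t + t'), (u + u'); split; first exact: idealD.
  by rewrite mulrDl addrACA.
- move=> r _ [t [u [It ->]]]; exists (r * t), (r * u).
  by split; [exact: idealZl | rewrite mulrDr mulrA].
Qed.

Lemma adjoin_sub I g : subset I (adjoin I g).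
Proof. by move=> x Ix; exists x, 0; rewrite mul0r addr0. Qed.

Lemma adjoin_mem I g : is_ideal I -> adjoin I g g.
Proof. by move=> hI; exists 0, 1; rewrite mul1r add0r; split=> //; apply: ideal0. Qed.

Section Noetherian.
Hypothesis noethR : noetherian R.

(** Otherwise every member of [F] has a strictly larger one, and dependent choice iterates this into
    a chain that never stabilizes. *)
Lemma noeth_max (F : (R -> Prop) -> Prop) :
  (exists2 I, is_ideal I & F I) ->
  exists I, [/\ is_ideal I, F I &
    forall J, is_ideal J -> F J -> subset I J -> subset J I].
Proof.
move=> [I0 hI0 FI0]; apply: contrapT => noMax.
pose T := {I : R -> Prop | is_ideal I /\ F I}.
have step (I : T) : exists J : T,
    subset (sval I) (sval J) /\ ~ subset (sval J) (sval I).
  case: I => I [hI FI] /=; apply: contrapT => noJ; apply: noMax.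
  exists I; split=> // J hJ FJ IJ; apply: contrapT => nJI.
  by apply: noJ; exists (exist _ J (conj hJ FJ)).
have [g hg] := choice step.
pose C n := iter n g (exist _ I0 (conj hI0 FI0) : T).
have [|n|n hn] := @noethR (fun n => sval (C n)).
- by move=> n; case: (svalP (C n)).
- by case: (hg (C n)).
- by case: (hg (C n)) => _ []; exact: (hn n.+1 (leqnSn n)).
Qed.

Lemma noeth_ind (Pr : (R -> Prop) -> Prop) :
  (forall I, is_ideal I ->
     (forall J, is_ideal J -> subset I J -> ~ subset J I -> Pr J) -> Pr I) ->
  forall I, is_ideal I -> Pr I.
Proof.
move=> IH I hI; apply: contrapT => nPr.
have [|J [hJ nJ maxJ]] := @noeth_max (fun J => ~ Pr J); first by exists I.
apply: nJ; apply: IH => // K hK JK nKJ; apply: contrapT => nK.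
exact/nKJ/maxJ.
Qed.

(* This plays the role of finite generation: a finite set of generators of I
   would be covered by one member of the directed family. *)
Lemma noeth_directed (T : Type) (D : T -> Prop) (Phi : T -> R -> Prop) I :
  (exists t, D t) -> (forall t, D t -> is_ideal (Phi t)) ->
  (forall s t, D s -> D t ->
     exists u, [/\ D u, subset (Phi s) (Phi u) & subset (Phi t) (Phi u)]) ->
  (forall x, I x -> exists2 t, D t & Phi t x) ->
  exists2 t, D t & subset I (Phi t).
Proof.
move=> [t0 Dt0] idPhi dirPhi covPhi.
have [|J [hJ [t Dt ->] maxJ]] := @noeth_max (fun J => exists2 t, D t & J = Phi t).
  by exists (Phi t0); [exact: idPhi | exists t0].
exists t => // x /covPhi[s Ds sx].
have [u [Du su tu]] := dirPhi _ _ Ds Dt.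
by apply: (maxJ _ (idPhi _ Du) _ tu _ (su _ sx)); exists u.
Qed.

(** An ideal maximal among those containing [I] and missing [T] is prime: adjoining either of two
    outside elements meets [T], and so does the product. *)
Lemma prime_exists I (T : R -> Prop) : is_ideal I -> mult_system T ->
  (forall x, T x -> ~ I x) ->
  exists P, [/\ is_prime P, subset I P & forall x, T x -> ~ P x].
Proof.
move=> hI [T1 TM] dIT.
have [|P [hP [IP dP] maxP]] :=
  @noeth_max (fun J => subset I J /\ forall x, T x -> ~ J x).
  by exists I => //; split=> // y.
exists P; split=> //; split=> //; first exact: dP.
have adj x : ~ P x -> exists2 t, T t & adjoin P x t.
  move=> nPx; apply: contrapT => nT; apply: nPx.
  apply: maxP (adjoin_mem x hP); [exact: adjoin_ideal| |exact: adjoin_sub].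
  split=> [y /IP/adjoin_sub|y Ty ay]; [by []|by apply: nT; exists y].
move=> x y Pxy; apply: contrapT => /not_orP[/adj[s' Ts [s [u [Ps eqs]]]]].
move=> /adj[t' Tt [t [v [Pt eqt]]]]; apply: (dP _ (TM _ _ Ts Tt)).
rewrite eqs eqt mulrDl; apply: (idealD hP); first exact: idealZr.
rewrite mulrDr; apply: (idealD hP); first exact: idealZl.
by rewrite mulrACA; apply: idealZl.
Qed.

(** Noetherian induction: if [x * y] lies in [I], a prime over [I] contains [x] or [y]. The list may
    include nonminimal primes, but every minimal prime contains, hence equals, a member. *)
Lemma finite_primes : exists L : seq (R -> Prop),
  (forall P, List.In P L -> is_prime P) /\
  forall Q, is_prime Q -> exists2 P, List.In P L & subset P Q.
Proof.
suff H I : is_ideal I -> exists L : seq (R -> Prop),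
    (forall P, List.In P L -> is_prime P) /\
    forall Q, is_prime Q -> subset I Q -> exists2 P, List.In P L & subset P Q.
  have [L [LP LQ]] := H _ zero_ideal.
  exists L; split=> // Q hQ; apply: LQ => // _ ->; case: hQ => hQ _ _.
  exact: ideal0.
move: I; apply: noeth_ind => I hI IH.
have [I1|nI1] := EM (I 1).
  by exists [::]; split=> // Q [_ Q1 _] /(_ 1 I1).
have [pI|nI] := EM (is_prime I).
  by exists [:: I]; split=> [P [<-|]//|Q _ IQ]; exists I => //; left.
have [x [y [Ixy Ix Iy]]] : exists x y, [/\ I (x * y), ~ I x & ~ I y].
  apply: contrapT => H; apply: nI; split=> // x y Ixy.
  by apply: contrapT => /not_orP[Ix Iy]; apply: H; exists x, y.
have ext z : ~ I z -> exists L : seq (R -> Prop),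
    (forall P, List.In P L -> is_prime P) /\ forall Q, is_prime Q ->
      subset (adjoin I z) Q -> exists2 P, List.In P L & subset P Q.
  move=> Iz; apply: IH; [exact: adjoin_ideal|exact: adjoin_sub|].
  by move=> /(_ z (adjoin_mem z hI)).
have [L1 [pL1 L1Q]] := ext x Ix; have [L2 [pL2 L2Q]] := ext y Iy.
exists (L1 ++ L2); split=> [P /(@List.in_app_or _ L1 L2 P)[]|Q pQ IQ]; auto.
have adjQ z : Q z -> subset (adjoin I z) Q.
  move=> Qz _ [t [u [It ->]]]; have [hQ _ _] := pQ.
  by apply: idealD => //; [exact: IQ | exact: idealZl].
have [_ _ QM] := pQ; case: (QM _ _ (IQ _ Ixy)) => [/adjQ Qx|/adjQ Qy].
  by have [P LP PQ] := L1Q _ pQ Qx; exists P => //; apply: List.in_or_app; left.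
by have [P LP PQ] := L2Q _ pQ Qy; exists P => //; apply: List.in_or_app; right.
Qed.

End Noetherian.

(** If the [c] found for the tail lies in the new prime [P], it is corrected by some [z] in [I]
    outside [P] that lies in every tail prime not contained in [P]. *)
Lemma prime_avoidance (L : seq (R -> Prop)) I : is_ideal I ->
  (forall P, List.In P L -> is_prime P) ->
  (forall P, List.In P L -> ~ subset I P) ->
  exists2 c, I c & forall P, List.In P L -> ~ P c.
Proof.
move=> hI; elim: L => [|P L IHL] pL nIL; first by exists 0; [exact: ideal0|].
have [||c Ic cL] := IHL.
- by move=> ? ?; apply: pL; right.
- by move=> ? ?; apply: nIL; right.
have pP : is_prime P by apply: pL; left.
have nIP : ~ subset I P by apply: nIL; left.
have [Pc|nPc] := EM (P c); last by exists c => // Q [<-|/cL].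
have [z [Iz nPz zL]] : exists z, [/\ I z, ~ P z &
    forall Q, List.In Q L -> ~ subset Q P -> Q z].
  have {}pL Q : List.In Q L -> is_prime Q by move=> LQ; apply: pL; right.
  elim: L {IHL nIL cL} pL => [|Q L IHL] pL.
    have /existsNP[z /not_implyP[Iz nPz]] := nIP.
    by exists z.
  have [|z [Iz nPz zL]] := IHL; first by move=> ? ?; apply: pL; right.
  have [QP|/existsNP[y /not_implyP[Qy nPy]]] := EM (subset Q P).
    by exists z; split=> // Q' [<- /(_ QP)//|/zL].
  exists (y * z); split; [exact: idealZl | exact: primeNM |].
  move=> Q' [<- _|LQ' /(zL _ LQ') Q'z].
    by have [hQ _ _] := pL Q (or_introl erefl); apply: idealZr.
  by have [hQ _ _] := pL Q' (or_intror LQ'); apply: idealZl.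
have hP : is_ideal P by case: pP.
exists (c + z); first exact: idealD.
have nPcz : ~ P (c + z).
  by move=> Pcz; apply: nPz; rewrite -(addKr c z) addrC; apply: idealB.
(* A [Q] inside [P] misses [c + z] because [P] does; any other [Q] contains [z] but not [c]. *)
move=> Q [<- //|LQ Qcz]; have [QP|nQP] := EM (subset Q P); first exact/nPcz/QP.
have [hQ _ _] := pL Q (or_intror LQ).
by apply: (cL Q LQ); rewrite -(addrK z c); apply: (idealB hQ) => //; apply: zL.
Qed.

End IdealTheory.

Lemma prime_pullback (R S : comPzRingType) (f : {rmorphism R -> S}) (Q : S -> Prop) :
  is_prime Q -> is_prime (fun r => Q (f r)).
Proof.
move=> [hQ Q1 QM]; split; last by move=> x y; rewrite rmorphM => /QM.
  split; first by rewrite rmorph0; apply: (ideal0 hQ).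
  - by move=> x y Qx Qy; rewrite rmorphD; apply: (idealD hQ).
  - by move=> r x Qx; rewrite rmorphM; apply: (idealZl _ hQ).
by rewrite rmorph1.
Qed.

(** * The quotient by a prime as an integral domain *)

Definition prime_pred (R : comNzRingType) (P : R -> Prop) (pP : is_prime P) : pred R :=
  fun x => `[<P x>].

Section Quotient.
Variables (R : comNzRingType) (P : R -> Prop) (pP : is_prime P).

Fact prime_pred_idealr : idealr_closed (prime_pred pP).
Proof.
have [[P0 PD PM] P1 _] := pP; split; [exact/asboolP | exact/asboolPn |].
move=> a x y /asboolP Px /asboolP Py; apply/asboolP.
by apply: PD => //; apply: PM.
Qed.

Fact prime_pred_prime : prime_idealr_closed (prime_pred pP).
Proof.
have [_ _ PM] := pP => x y /asboolP /PM[] h; apply/orP; [left|right]; exact/asboolP.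
Qed.

HB.instance Definition _ := isIdealr.Build R (prime_pred pP) prime_pred_idealr.
HB.instance Definition _ :=
  isPrimeIdealrClosed.Build R (prime_pred pP) prime_pred_prime.

Definition quot_ideal : prime_idealr R := PrimeIdealr.clone R (prime_pred pP) _.
Definition prime_quot : Type := @Quotient.quot R quot_ideal.
HB.instance Definition _ := GRing.ComNzRing.on prime_quot.

(** An [idomainType] carries a boolean unit test and a total inverse; both are obtained classically,
    with nonunits sent to themselves. *)
Definition prime_quot_unit : pred prime_quot := fun x => `[<exists y, y * x = 1>].
Definition prime_quot_inv (x : prime_quot) : prime_quot :=
  match pselect (exists y, y * x = 1) with left h => sval (cid h) | _ => x end.

Fact prime_quot_mulVx : {in prime_quot_unit, left_inverse 1 prime_quot_inv *%R}.
Proof.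
move=> x /asboolP ux; rewrite /prime_quot_inv.
by case: pselect => // h; case: (cid h).
Qed.

Fact prime_quot_unitPl x y : y * x = 1 -> prime_quot_unit x.
Proof. by move=> yx; apply/asboolP; exists y. Qed.

Fact prime_quot_inv_out : {in [predC prime_quot_unit], prime_quot_inv =1 id}.
Proof. by move=> x /asboolPn nux; rewrite /prime_quot_inv; case: pselect. Qed.

HB.instance Definition _ := GRing.ComNzRing_hasMulInverse.Build prime_quot
  prime_quot_mulVx prime_quot_unitPl prime_quot_inv_out.

Fact prime_quot_integral : GRing.integral_domain_axiom prime_quot.
Proof. exact: Quotient.rquot_IdomainAxiom. Qed.

HB.instance Definition _ :=
  GRing.ComUnitRing_isIntegral.Build prime_quot prime_quot_integral.

Lemma prime_quotient : exists (D : idomainType) (pi : {rmorphism R -> D}),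
  (forall d, exists r, pi r = d) /\ (forall r, pi r = 0 <-> P r).
Proof.
pose Q := @Quotient.quot R quot_ideal.
exists prime_quot, (\pi_Q)%qT; split=> [d|r].
  by exists (repr (d : Q)); exact: (reprK (d : Q)).
have -> : (\pi_Q r = 0)%qT <-> (\pi_Q r = \pi_Q 0)%qT by rewrite (rmorph0 (\pi_Q)%qT).
split=> [/eqP|Pr]; last apply/eqP.
  by rewrite -Quotient.idealrBE subr0 => /asboolP.
by rewrite -Quotient.idealrBE subr0; apply/asboolP.
Qed.
End Quotient.

Lemma frobeniusD (R : comNzRingType) p (pR : p \in [pchar R]) e (x y : R) :
  (x + y) ^+ (p ^ e) = x ^+ (p ^ e) + y ^+ (p ^ e).
Proof.
apply: exprDn_pchar.
by rewrite (eq_pnat _ (pcharf_eq pR)) pnatX pnat_id ?(pcharf_prime pR).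
Qed.

Lemma mulf_cancel (K : fieldType) (x y z : K) : y != 0 -> x * y * (z / y) = x * z.
Proof. by move=> y0; rewrite mulrACA divff // mulr1. Qed.

(** * One-dimensional localizations *)

Section HeightOne.
Variables (D : idomainType) (Q : D -> Prop).
Hypotheses (noethD : noetherian D) (primeQ : is_prime Q).
Hypothesis minQ : forall P, is_prime P -> subset P Q -> ~ subset Q P ->
  forall z, P z -> z = 0.

Let QN1 : ~ Q 1. Proof. by case: primeQ. Qed.

(** Ideals of the local ring D_Q are represented by their contractions to D, so D_Q itself is never
    built. *)
Definition saturated (A : D -> Prop) :=
  is_ideal A /\ forall s r, ~ Q s -> A (s * r) -> A r.

Definition saturation (A : D -> Prop) (r : D) := exists2 s, ~ Q s & A (s * r).

Lemma saturation_saturated A : is_ideal A -> saturated (saturation A).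
Proof.
move=> hA; split; first split.
- by exists 1 => //; rewrite mulr0; apply: ideal0.
- move=> x y [s Qs Ax] [t Qt Ay]; exists (s * t); first exact: primeNM.
  rewrite mulrDr; apply: idealD => //; last by rewrite -mulrA; apply: idealZl.
  by rewrite [s * t]mulrC -mulrA; apply: idealZl.
- move=> r x [s Qs Ax]; exists s => //.
  by rewrite mulrCA; apply: idealZl.
- move=> s r Qs [t Qt Ar]; exists (t * s); first exact: primeNM.
  by rewrite -mulrA.
Qed.

Lemma saturation_sub A : subset A (saturation A).
Proof. by move=> x Ax; exists 1 => //; rewrite mul1r. Qed.

Lemma saturation_mono A B : subset A B -> subset (saturation A) (saturation B).
Proof. by move=> AB x [s Qs /AB]; exists s. Qed.

(** A maximal colon ideal (A : g) with [g] outside [A] is prime. It lies in [Q] because [A] is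
    saturated, and it contains [b], so [minQ] makes it equal to [Q]. *)
Lemma socle_element A b : saturated A -> A b -> b != 0 -> ~ A 1 ->
  exists2 g, ~ A g & forall y, Q y -> A (y * g).
Proof.
move=> [hA satA] Ab b0 A1.
have colI g : is_ideal (fun r => A (r * g)).
  split; first by rewrite mul0r; apply: ideal0.
    by move=> x y Ax Ay; rewrite mulrDl; apply: idealD.
  by move=> r x Ax; rewrite -mulrA; apply: idealZl.
have [|J [hJ [g Ag eJ] maxJ]] :=
    noeth_max noethD (F := fun J => exists2 g, ~ A g & J = fun r => A (r * g)).
  by exists (fun r => A (r * 1)); [exact: colI | exists 1].
rewrite {J}eJ in hJ maxJ; exists g => //.
have pJ : is_prime (fun r => A (r * g)).
  split=> //; first by rewrite mul1r.
  move=> x y Axyg; have [?|Ayg] := EM (A (y * g)); [by right | left].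
  apply: (maxJ _ (colI (y * g))); last by rewrite mulrA.
    by exists (y * g).
  by move=> r; rewrite mulrCA; apply: idealZl.
apply: contrapT => /existsNP[y /not_implyP[Qy Ayg]].
have b_eq0 : b = 0.
  apply: (minQ pJ); last exact: (idealZr g hA Ab).
    by move=> r Arg; apply: contrapT => Qr; apply/Ag/(satA r).
  by move/(_ y Qy).
by rewrite b_eq0 eqxx in b0.
Qed.

Lemma decreasing_sub (C : nat -> D -> Prop) m n :
  (forall n, subset (C n.+1) (C n)) -> (m <= n)%N -> subset (C n) (C m).
Proof.
move=> decC /subnKC <-; elim: (n - m)%N => [|k IHk]; first by rewrite addn0.
by rewrite addnS => x /decC/IHk.
Qed.

(** This is the finite length of D_Q/A D_Q. By induction the chain enlarged by a socle element [g]
    stabilizes; the original chain can then drop only where it loses [g]. *)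
Lemma saturated_dcc A b : saturated A -> A b -> b != 0 ->
  forall C : nat -> D -> Prop,
    (forall n, saturated (C n)) -> (forall n, subset A (C n)) ->
    (forall n, subset (C n.+1) (C n)) ->
  exists m, forall n, (m <= n)%N -> subset (C m) (C n).
Proof.
move=> sA Ab b0; have hA := sA.1.
move: A hA sA Ab; apply: (noeth_ind noethD) => A hA IH sA Ab C sC AC decC.
have mono m n := @decreasing_sub C m n decC.
have [A1|A1] := EM (A 1).
  exists 0%N => n _ x _; rewrite -(mulr1 x).
  by apply: idealZl; [exact: (sC n).1 | exact: AC].
have [g Ag QAg] := socle_element sA Ab b0 A1.
pose B I := saturation (adjoin I g).
have sB I : is_ideal I -> saturated (B I).
  by move=> hI; apply/saturation_saturated/adjoin_ideal.
have IB I : subset I (B I) by move=> x /(adjoin_sub g)/saturation_sub.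
have Bmono I J : subset I J -> subset (B I) (B J).
  by move=> IJ; apply: saturation_mono => _ [t [u [/IJ Jt ->]]]; exists t, u.
have Bg : B A g by apply/saturation_sub/adjoin_mem.
have [||||||||m1 Hm1] := IH (B A) _ _ _ _ _ (fun n => B (C n)).
- exact: (sB _ hA).1.
- exact: IB.
- by move/(_ g Bg).
- exact: sB.
- exact: IB Ab.
- by move=> n; apply/sB/(sC n).1.
- by move=> n; apply/Bmono/AC.
- by move=> n; apply/Bmono/decC.
(* In s r = t + u g the term u g lies in [C m]. Either [u] is in [Q] and u g is in [A], or
   saturation puts [g] in [C m], hence in [C n]. *)
have key m n r : B (C n) r -> C m r -> (C m g -> C n g) -> subset (C n) (C m) ->
    C n r.
  move=> [s Qs [t [u [Ct esr]]]] Cr Cg Cnm; have [hn satn] := sC n.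
  apply: (satn s) => //; rewrite esr; apply: idealD => //.
  have Cug : C m (u * g).
    have -> : u * g = s * r - t by rewrite esr addrAC subrr add0r.
    by apply: (idealB (sC m).1); [exact: (idealZl _ (sC m).1) | exact: Cnm].
  have [/QAg/AC//|Qu] := EM (Q u).
  by apply: idealZl => //; apply/Cg/((sC m).2 u).
have [allg|/existsNP[n0 ng]] := EM (forall n, C n g).
  exists m1 => n mn r Cr; apply: (key m1) => //; last exact: mono.
  exact/Hm1/IB.
exists (maxn m1 n0) => n mn r Cr.
have [m1n n0n] : (m1 <= n)%N /\ (n0 <= n)%N.
  by split; apply: leq_trans mn; rewrite ?leq_maxl ?leq_maxr.
apply: (key (maxn m1 n0)) => //; last exact: mono.
  apply: Hm1 => //; apply: (Bmono (C (maxn m1 n0))); last exact: IB.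
  by apply: mono; rewrite leq_maxl.
by move/(mono _ _ (leq_maxr m1 n0)) => /ng.
Qed.

(** * Polynomial relations for elements of the fraction field *)

Definition frac_eval (x : {fraction D}) (Z : {poly D}) : {fraction D} :=
  (map_poly (@tofrac D) Z).[x].

Lemma frac_evalD x Y Z : frac_eval x (Y + Z) = frac_eval x Y + frac_eval x Z.
Proof. by rewrite /frac_eval rmorphD hornerD. Qed.

Lemma frac_evalM x Y Z : frac_eval x (Y * Z) = frac_eval x Y * frac_eval x Z.
Proof. by rewrite /frac_eval rmorphM hornerM. Qed.

Lemma frac_evalC x c : frac_eval x c%:P = tofrac c.
Proof. by rewrite /frac_eval map_polyC hornerC. Qed.

Lemma frac_evalX x : frac_eval x 'X = x.
Proof. by rewrite /frac_eval map_polyX hornerX. Qed.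

Lemma frac_evalB x Y Z : frac_eval x (Y - Z) = frac_eval x Y - frac_eval x Z.
Proof. by rewrite /frac_eval rmorphB hornerD hornerN. Qed.

Lemma frac_evalXn x n : frac_eval x 'X^n = x ^+ n.
Proof. by rewrite /frac_eval map_polyXn hornerXn. Qed.

Lemma frac_eval_sum x n (F : nat -> {poly D}) :
  frac_eval x (\sum_(i < n) F i) = \sum_(i < n) frac_eval x (F i).
Proof. by rewrite /frac_eval rmorph_sum horner_sum. Qed.

Lemma noetherian_sequence (g : nat -> D) :
  exists n (r : nat -> D), g n = \sum_(i < n) r i * g i.
Proof.
pose Phi n y := exists r : nat -> D, y = \sum_(i < n) r i * g i.
have mono m n : (m <= n)%N -> subset (Phi m) (Phi n).
  move=> mn _ [r ->]; exists (fun i => if (i < m)%N then r i else 0).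
  rewrite (big_ord_widen _ (fun i => r i * g i) mn) big_mkcond /=.
  by apply: eq_bigr => i _; case: ifP; rewrite ?mul0r.
have idPhi n : is_ideal (Phi n).
  split.
  - by exists (fun=> 0); rewrite big1 // => i _; rewrite mul0r.
  - move=> _ _ [r ->] [s ->]; exists (fun i => r i + s i).
    by rewrite -big_split; apply: eq_bigr => i _; rewrite mulrDl.
  - move=> s _ [r ->]; exists (fun i => s * r i).
    by rewrite mulr_sumr; apply: eq_bigr => i _; rewrite mulrA.
have [n hn] := @noethD _ idPhi (fun n => mono n n.+1 (leqnSn n)).
exists n; apply: (hn n.+1 (leqnSn n)).
exists (fun i => (i == n)%:R); rewrite big_ord_recr /= eqxx mul1r.
by rewrite big1 ?add0r // => i _; rewrite (ltn_eqF (ltn_ord i)) mul0r.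
Qed.

(* The Krull-Akizuki argument: D[x]/bD[x] localized at Q is a finite module,
   so some power of x is a combination of lower ones modulo bD[x]. *)
Lemma frac_relation (x : {fraction D}) a b :
  b != 0 -> Q b -> tofrac b * x = tofrac a ->
  exists2 F : {poly D}, frac_eval x F = 0 & exists i, ~ Q F`_i.
Proof.
move=> b0 Qb bx.
(* [C n] is the contraction to D of b^n D_Q[x] + b D_Q. *)
pose C n r := exists s Z t, [/\ ~ Q s &
  tofrac (s * r) = tofrac (b ^+ n) * frac_eval x Z + tofrac (b * t)].
have sC n : saturated (C n).
  split; first split.
  - by exists 1, 0, 0; split=> //; rewrite -polyC0 frac_evalC !(mulr0, tofrac0, addr0).
  - move=> y z [s [Z [t [Qs ey]]]] [s' [Z' [t' [Qs' ez]]]].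
    exists (s * s'), (s'%:P * Z + s%:P * Z'), (s' * t + s * t').
    split; first exact: primeNM.
    have -> : s * s' * (y + z) = s' * (s * y) + s * (s' * z) by ring.
    rewrite frac_evalD !frac_evalM !frac_evalC tofracD.
    rewrite (tofracM s' (s * y)) (tofracM s (s' * z)) ey ez.
    rewrite !(tofracM, tofracD); ring.
  - move=> r y [s [Z [t [Qs ey]]]]; exists s, (r%:P * Z), (r * t); split=> //.
    rewrite (mulrCA s) (tofracM r) ey frac_evalM frac_evalC !tofracM; ring.
  - move=> s r Qs [s' [Z [t [Qs' e]]]]; exists (s' * s), Z, t.
    by split; [exact: primeNM | rewrite -mulrA].
have bC n r : C n (b * r).
  by exists 1, 0, r; split=> //; rewrite mul1r -polyC0 frac_evalC tofrac0 mulr0 add0r.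
have decC n : subset (C n.+1) (C n).
  move=> r [s [Z [t [Qs e]]]]; exists s, (b%:P * Z), t; split=> //.
  by rewrite frac_evalM frac_evalC e exprSr tofracM mulrA.
have [m Hm] : exists m, forall n, (m <= n)%N -> subset (C n) (C n.+1).
  have sA := saturation_saturated (principal_ideal b).
  have [||m Hm] := saturated_dcc sA _ b0 sC _ decC.
  - by apply: saturation_sub; exists 1; rewrite mul1r.
  - move=> n r [s Qs [t es]]; apply: ((sC n).2 s r Qs).
    by rewrite es mulrC; apply: bC.
  exists m => n mn r /(decreasing_sub decC mn); exact: Hm (leqW mn) r.
have fb0 : tofrac b != 0 by rewrite tofrac_eq0.
(* Modulo b D_Q[x], the denominator b^n of Z(x) is lowered to b^m. From r = b^(n+1) Z(x) and s r =
   b^(n+2) Z1(x) + b t one gets s Z(x) - b Z1(x) = t/b^n. *)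
have red n r Z : tofrac r = tofrac (b ^+ n) * frac_eval x Z ->
    exists s g Z', ~ Q s /\ tofrac (b ^+ m) * frac_eval x (s%:P * Z - b%:P * Z') = tofrac g.
  elim: n r Z => [|n IHn] r Z e.
    exists 1, (b ^+ m * r), 0; split=> //.
    by rewrite mulr0 subr0 mul1r tofracM e expr0 tofrac1 mul1r.
  have [nm|mn] := leqP n.+1 m.
    exists 1, (b ^+ (m - n.+1) * r), 0; split=> //.
    by rewrite mulr0 subr0 mul1r tofracM e mulrA -tofracM -exprD subnK.
  have [s [Z1 [t [Qs et]]]] : C n.+2 r.
    apply: (Hm n.+1 (ltnW mn)); exists 1, Z, 0; split=> //.
    by rewrite mul1r mulr0 tofrac0 addr0.
  have [|s' [g [Z' [Qs' e']]]] := IHn t (s%:P * Z - b%:P * Z1).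
    apply: (mulfI fb0); rewrite -tofracM frac_evalB !frac_evalM !frac_evalC.
    move: et; rewrite (tofracM s r) e !tofracXn !exprS => et.
    symmetry; transitivity (tofrac s * (tofrac b * tofrac b ^+ n * frac_eval x Z)
      - tofrac b * (tofrac b * tofrac b ^+ n) * frac_eval x Z1); first by ring.
    by rewrite et; ring.
  exists (s' * s), g, (s'%:P * Z1 + Z'); split; first exact: primeNM.
  rewrite -e'; congr (_ * frac_eval x _); rewrite polyCM; ring.
have pow i : exists s g Z, ~ Q s /\
    tofrac (b ^+ m) * frac_eval x (s%:P * 'X^i - b%:P * Z) = tofrac g.
  apply: (red i (a ^+ i)).
  by rewrite frac_evalXn !tofracXn -exprMn bx.
have [s /choice[g /choice[Z hs]]] := choice pow.
have [n [r gn]] := noetherian_sequence g.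
pose G i := (s i)%:P * 'X^i - b%:P * Z i.
(* Multiplied by b^m, the value of [G i] at [x] is [g i], so the relation among the [g i] makes this
   polynomial vanish at [x]. *)
exists (G n - \sum_(i < n) (r i)%:P * G i).
  have fbm0 : tofrac (b ^+ m) != 0 by rewrite tofrac_eq0 expf_neq0.
  apply: (mulfI fbm0); rewrite mulr0 frac_evalB mulrBr (hs n).2 gn.
  apply/eqP; rewrite subr_eq0; apply/eqP.
  rewrite (frac_eval_sum _ _ (fun i => (r i)%:P * G i)) rmorph_sum mulr_sumr.
  apply: eq_bigr => i _.
  by rewrite frac_evalM frac_evalC mulrCA (hs i).2 rmorphM.
exists n => Qn; apply: (hs n).1; have [hQ _ _] := primeQ.
(* Modulo [b], which lies in [Q], the coefficient of X^n is [s n]. *)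
have -> : s n = (G n - \sum_(i < n) (r i)%:P * G i)`_n +
    ((Z n)`_n - \sum_(i < n) r i * (Z i)`_n) * b.
  rewrite coefB coef_sum coefB !coefCM coefXn eqxx mulr1.
  rewrite (eq_bigr (fun i : 'I_n => - (b * (r i * (Z i)`_n)))).
    rewrite sumrN -mulr_sumr; ring.
  move=> i _; rewrite coefCM coefB !coefCM coefXn (gtn_eqF (ltn_ord i)) mulr0.
  ring.
by apply: idealD => //; apply: idealZl.
Qed.

(** The powers of [t] are distinct modulo [Q], since a coincidence would make [t] a unit there.
    Hence some power is not a root of [F] modulo [Q]. *)
Lemma nonroot_mod (t : D) (F : {poly D}) : ~ Q t -> ~ adjoin Q t 1 ->
  (exists i, ~ Q F`_i) -> exists u, ~ Q F.[u].
Proof.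
move=> Qt adj1 [i0 Fi0]; have [E [pi [_ piQ]]] := prime_quotient primeQ.
have piF0 : map_poly pi F != 0.
  apply/eqP => /(congr1 (fun P : {poly E} => P`_i0)).
  by rewrite coef_map coef0 => /piQ.
apply: contrapT => allQ.
pose rs := [seq pi t ^+ i | i <- iota 0 (size (map_poly pi F))].
suff /(max_poly_roots piF0) : all (root (map_poly pi F)) rs.
  rewrite size_map size_iota ltnn => h; suff /h : uniq rs by [].
  rewrite map_inj_uniq ?iota_uniq // => i j.
  wlog ij : i j / (i <= j)%N.
    by move=> W; have [/W//|/ltnW /W h' /esym/h'] := leqP i j.
  rewrite -(subnKC ij) exprD => /eqP; rewrite -{1}(mulr1 (pi t ^+ i)).
  have pit0 : pi t != 0 by apply/eqP => /piQ.
  rewrite -subr_eq0 -mulrBr mulf_eq0 expf_eq0 (negPf pit0) andbF /= subr_eq0.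
  case: (j - i)%N => [|k]; first by rewrite addn0.
  rewrite -rmorphXn -{1}(rmorph1 pi) -subr_eq0 -rmorphB => /eqP/piQ Q1t.
  by case: adj1; exists (1 - t ^+ k.+1), (t ^+ k); rewrite -exprSr subrK.
apply/allP => _ /mapP[i _ ->]; rewrite -rmorphXn /root horner_map.
by apply/eqP/piQ; apply: contrapT => nQ; apply: allQ; exists (t ^+ i).
Qed.

(** * Principal reductions in characteristic p *)

Section Frobenius.
Variable p : nat.
Hypothesis pcharD : p \in [pchar D].

(* Tight closure of the principal ideal (f) with no lower bound on q; this is
   the form in which an integral dependence relation is used below. *)
Definition principal_closure (f z : D) :=
  exists2 c, c != 0 & forall e, exists r, c * z ^+ (p ^ e) = r * f ^+ (p ^ e).

Lemma principal_closure_ideal f : is_ideal (principal_closure f).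
Proof.
split.
- exists 1; rewrite ?oner_neq0 // => e; exists 0; rewrite expr0n.
  have /prime.prime_gt0 p0 := pcharf_prime pcharD.
  by rewrite expn_eq0 -leqn0 leqNgt p0 /= mulr0 mul0r.
- move=> x y [c c0 cx] [d d0 dy]; exists (c * d); first exact: mulf_neq0.
  move=> e; have [r er] := cx e; have [s es] := dy e; exists (d * r + c * s).
  rewrite (frobeniusD pcharD) mulrDr -mulrA [d * _]mulrC mulrA er.
  by rewrite -[c * d * _]mulrA es; ring.
- move=> s x [c c0 cx]; exists c => // e; have [r er] := cx e.
  by exists (s ^+ (p ^ e) * r); rewrite exprMn mulrCA er mulrA.
Qed.

Lemma principal_closure_trans f g k z :
  principal_closure g z -> principal_closure f (k * g) -> principal_closure f (k * z).
Proof.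
move=> [c c0 cz] [d d0 dg]; exists (c * d); first exact: mulf_neq0.
move=> e; have [r er] := cz e; have [s es] := dg e; exists (r * s).
rewrite -[r * s * _]mulrA -es !exprMn.
by transitivity (d * k ^+ (p ^ e) * (c * z ^+ (p ^ e))); [ring | rewrite er; ring].
Qed.

Lemma principal_closure_mul f g : principal_closure f (g * f).
Proof.
by exists 1; rewrite ?oner_neq0 // => e; exists (g ^+ (p ^ e)); rewrite mul1r exprMn.
Qed.

(** For z = b/f the relation [L] makes every power of k z a D-combination of 1, ..., z^d. Thus
    [f ^+ d] is a common denominator, and it serves as the multiplier. *)
Lemma integral_principal_closure (f b k : D) (L : {poly D}) d : f != 0 ->
  (size L <= d.+1)%N -> L`_d = k -> frac_eval (tofrac b / tofrac f) L = 0 ->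
  principal_closure f (k * b).
Proof.
set z := _ / _ => f0 sL Ld evL.
have ff0 : tofrac f != 0 by rewrite tofrac_eq0.
have red n : exists2 G : {poly D}, (size G <= d.+1)%N &
    (tofrac k * z) ^+ n = frac_eval z G.
  elim: n => [|n [G sG eG]].
    by exists 1; rewrite ?size_poly1 // expr0 -polyC1 frac_evalC tofrac1.
  (* Multiplication by k z raises the degree; a multiple of X L cancels the coefficient of
     X^(d+1). *)
  exists (k%:P * (G * 'X) - (G`_d)%:P * (L * 'X)).
    apply/leq_sizeP => j dj; rewrite coefB !coefCM !coefMX.
    case: j dj => // j; rewrite ltnS /= leq_eqVlt => /predU1P[<-|dj].
      by rewrite Ld mulrC subrr.
    rewrite (nth_default _ (leq_trans sG dj)) (nth_default _ (leq_trans sL dj)).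
    by rewrite !mulr0 subrr.
  by rewrite frac_evalB !frac_evalM evL frac_evalX !frac_evalC exprS eG; ring.
have homog (G : {poly D}) : (size G <= d.+1)%N ->
    exists r, tofrac (f ^+ d) * frac_eval z G = tofrac r.
  move=> sG; exists (\sum_(i < d.+1) G`_i * (f ^+ (d - i) * b ^+ i)).
  have eG : G = \sum_(i < d.+1) (G`_i)%:P * 'X^i.
    rewrite -{1}(coefK G) poly_def (big_ord_widen _ (fun i => G`_i *: 'X^i) sG).
    rewrite big_mkcond; apply: eq_bigr => i _; rewrite -mul_polyC.
    by case: ltnP => // /(nth_default 0) ->; rewrite mul0r.
  rewrite {1}eG (frac_eval_sum _ _ (fun i => (G`_i)%:P * 'X^i)) mulr_sumr rmorph_sum.
  apply: eq_bigr => i _; rewrite frac_evalM frac_evalC frac_evalXn expr_div_n.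
  rewrite !rmorphM !rmorphXn /=.
  have -> : tofrac f ^+ d = tofrac f ^+ (d - i) * tofrac f ^+ i.
    by rewrite -exprD subnK // -ltnS ltn_ord.
  by rewrite mulrCA mulf_cancel ?expf_neq0.
exists (f ^+ d); first exact: expf_neq0.
move=> e; have [G sG eG] := red (p ^ e)%N; have [r er] := homog G sG.
exists r; apply/eqP; rewrite -tofrac_eq !tofracM -er -eG !tofracXn tofracM.
rewrite !exprMn exprVn; apply/eqP.
by rewrite -!mulrA mulVf ?mulr1 // expf_neq0.
Qed.

Variable t : D.
Hypotheses (Qt : ~ Q t) (adjt : ~ adjoin Q t 1).

(** For [b] in [Q], a/b is a root of some [F] nonzero modulo [Q]. With F(u) outside [Q] and f = a -
    u b, the quotient f/b is a root of F(X + u), whose constant term F(u) becomes the top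
    coefficient of a relation for b/f. *)
Lemma two_generator_reduction (a b : D) : a != 0 -> b != 0 ->
  exists f k u v, [/\ f = u * a + v * b, f != 0, ~ Q k,
    principal_closure f (k * a) & principal_closure f (k * b)].
Proof.
move=> a0 b0; have [Qb|Qb] := EM (Q b); last first.
  (* Outside [Q], [b] is a unit of D_Q, and f = k = b works. *)
  exists b, b, 0, 1; split; rewrite ?mul0r ?add0r ?mul1r //.
    by rewrite mulrC; apply: principal_closure_mul.
  exact: principal_closure_mul.
have fb0 : tofrac b != 0 by rewrite tofrac_eq0.
pose x := tofrac a / tofrac b.
have bx : tofrac b * x = tofrac a by rewrite mulrC divfK.
have [F evF nQF] := frac_relation b0 Qb bx.
have [u nQu] := nonroot_mod Qt adjt nQF.
pose f := a - u * b; pose H := F \Po ('X + u%:P); pose w := x - tofrac u.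
have H0 : H`_0 = F.[u].
  by rewrite -horner_coef0 /H horner_comp !hornerE.
have evH : frac_eval w H = 0.
  rewrite -evF /frac_eval /H map_comp_poly horner_comp rmorphD /= map_polyX map_polyC.
  by rewrite !hornerE /w subrK.
have Q0 : Q 0 by case: primeQ => /ideal0.
have w0 : w != 0.
  apply/eqP => w0; apply: nQu; rewrite -H0; suff -> : H`_0 = 0 by [].
  apply/eqP; rewrite -tofrac_eq0 -evH w0 /frac_eval horner_coef0 coef_map.
  exact/eqP.
have fE : tofrac f = tofrac b * w.
  by rewrite tofracB tofracM /w mulrBr bx [tofrac u * _]mulrC.
have f0 : f != 0 by rewrite -tofrac_eq0 fE mulf_neq0.
pose d := (size H).-1.
have sH : size H = d.+1.
  rewrite prednK // size_poly_gt0; apply/eqP => H_eq0; apply: nQu.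
  by rewrite -H0 H_eq0 coef0.
have fkb : principal_closure f (F.[u] * b).
  (* The polynomial is [H] with its coefficients reversed. *)
  apply: (@integral_principal_closure f b _ (\poly_(j < d.+1) H`_(d - j)) d) => //.
    by rewrite coef_poly ltnSn subnn.
  have -> : tofrac b / tofrac f = w^-1 by rewrite fE invfM mulrA mulfV ?mul1r.
  rewrite poly_def (frac_eval_sum _ _ (fun j => H`_(d - j) *: 'X^j)).
  apply: (mulfI (expf_neq0 d w0)); rewrite mulr0 -[RHS]evH mulr_sumr.
  rewrite [RHS]/frac_eval horner_coef size_map_poly_id0; last first.
    by rewrite tofrac_eq0 lead_coef_eq0 -size_poly_gt0 sH.
  rewrite sH (reindex_inj rev_ord_inj) /=; apply: eq_bigr => i _.
  rewrite coef_map -mul_polyC frac_evalM frac_evalC frac_evalXn subSS.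
  have id : (i <= d)%N by rewrite -ltnS ltn_ord.
  rewrite subKn // -{1}(subnK id) exprD exprVn /=.
  by rewrite [w ^+ _ * _]mulrC mulf_cancel ?expf_neq0 // mulrC.
exists f, F.[u], 1, (- u); split=> //; first by rewrite mul1r mulNr.
have -> : F.[u] * a = F.[u] * f + u * (F.[u] * b) by rewrite /f; ring.
have hf := principal_closure_ideal f.
by apply: (idealD hf); [exact: principal_closure_mul | exact: idealZl].
Qed.

(* In the one-dimensional local domain D_Q with infinite residue field every
   nonzero ideal has a principal reduction f; k clears the denominators. *)
Lemma principal_reduction I : is_ideal I -> (exists2 x, I x & x != 0) ->
  exists f k, [/\ I f, f != 0, ~ Q k & forall a, I a -> principal_closure f (k * a)].
Proof.
move=> hI [x0 Ix0 x00].
have colon_ideal f k : is_ideal (fun a => principal_closure f (k * a)).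
  have hf := principal_closure_ideal f; split.
  - by rewrite mulr0; apply: (ideal0 hf).
  - by move=> y z; rewrite mulrDr; apply: (idealD hf).
  - by move=> r y hy; rewrite mulrCA; apply: (idealZl _ hf).
(* By [two_generator_reduction] the candidates [f] are directed, so one serves all of [I]; here [k]
   still depends on the element of [I]. *)
have [||||f [If f0] If_sub] := noeth_directed noethD (I := I)
  (D := fun f => I f /\ f != 0)
  (Phi := fun f a => exists2 k, ~ Q k & principal_closure f (k * a)).
- by exists x0.
- move=> f _; split.
  + by exists 1 => //; apply: (ideal0 (colon_ideal f 1)).
  + move=> y z [k Qk hk] [l Ql hl]; exists (k * l); first exact: primeNM.
    apply: (idealD (colon_ideal f (k * l))).
      by rewrite mulrAC mulrC; apply: (idealZl _ (principal_closure_ideal f)).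
    by rewrite -mulrA; apply: (idealZl _ (principal_closure_ideal f)).
  + by move=> r y [k Qk hk]; exists k => //; apply: (idealZl _ (colon_ideal f k)).
- move=> a b [Ia a0] [Ib b0].
  have [f [k [u [v [fE f0 Qk fa fb]]]]] := two_generator_reduction a0 b0.
  exists f; split; first by split=> //; rewrite fE; apply: idealD => //; apply: idealZl.
    move=> z [l Ql hl]; exists (k * l); first exact: primeNM.
    rewrite -mulrA; apply: principal_closure_trans hl fa.
  move=> z [l Ql hl]; exists (k * l); first exact: primeNM.
  rewrite -mulrA; apply: principal_closure_trans hl fb.
- move=> a Ia; have [->|a0] := eqVneq a 0.
    by exists x0 => //; exists 1 => //; apply: (ideal0 (colon_ideal x0 1)).
  by exists a => //; exists 1 => //; apply: principal_closure_mul.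
(* A second passage to a directed family makes [k] uniform. *)
have [||||k Qk Ik] := noeth_directed noethD (I := I) (D := fun k => ~ Q k)
  (Phi := fun k a => principal_closure f (k * a)).
- by exists 1.
- by move=> k _; apply: colon_ideal.
- move=> k l Qk Ql; exists (k * l); split; first exact: primeNM.
    by move=> a hk; rewrite mulrAC mulrC; apply: (idealZl _ (principal_closure_ideal f)).
  by move=> a hl; rewrite -mulrA; apply: (idealZl _ (principal_closure_ideal f)).
- by move=> a /If_sub.
by exists f, k.
Qed.

End Frobenius.
End HeightOne.

(** * Two-dimensional domains *)

Lemma mult_systemX (R : comPzRingType) (W : R -> Prop) v n :
  mult_system W -> W v -> W (v ^+ n).
Proof.
move=> [W1 WM] Wv; elim: n => [|n IHn]; first by rewrite expr0.
by rewrite exprS; apply: WM.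
Qed.

Section Domain.
Variables (D : idomainType) (p : nat) (W I : D -> Prop).
Hypotheses (noethD : noetherian D) (pcharD : p \in [pchar D]).
Hypotheses (idealI : is_ideal I) (multW : mult_system W).

Let W1 : W 1. Proof. by case: multW. Qed.
Let WM v w : W v -> W w -> W (v * w). Proof. by case: multW => _; apply. Qed.

(* The graded pieces f^i/f^(i+1) are all isomorphic to D/f. *)
Lemma power_saturation (f : D) : f != 0 ->
  exists2 w, W w & forall n y v r, W v -> v * y = r * f ^+ n ->
    exists s, w ^+ n * y = s * f ^+ n.
Proof.
move=> f0.
(* One [w] realizes the W-saturation of (f): if v y is in (f) for some [v] in [W], so is w y. *)
have [||||w Ww hw] := noeth_directed noethD (D := W)
    (Phi := fun w y => exists r, w * y = r * f)
    (I := fun y => exists2 v, W v & exists r, v * y = r * f).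
- by exists 1.
- move=> w _; split.
  + by exists 0; rewrite mulr0 mul0r.
  + by move=> y z [r er] [s es]; exists (r + s); rewrite mulrDr er es mulrDl.
  + by move=> s y [r er]; exists (s * r); rewrite mulrCA er mulrA.
- move=> v w Wv Ww; exists (v * w); split; first exact: WM.
    by move=> y [r er]; exists (w * r); rewrite [v * w]mulrC -!mulrA er.
  by move=> y [r er]; exists (v * r); rewrite -!mulrA er.
- by move=> y [v Wv hv]; exists v.
exists w => //; elim=> [|n IHn] y v r Wv e; first by exists y; rewrite expr0 mulr1 mul1r.
have [y' wy] : exists y', w * y = y' * f.
  by apply: hw; exists v => //; exists (r * f ^+ n); rewrite e exprSr mulrA.
have [|s es] := IHn y' v (w * r) Wv.
  apply: (mulIf f0); rewrite -mulrA -wy mulrCA e exprSr; ring.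
by exists s; rewrite exprSr -mulrA wy mulrA es exprSr mulrA.
Qed.

Variables (x c0 : D) (e0 : nat).
Hypotheses (c0N0 : c0 != 0) (dimD : dim_lt D 3) (WN0 : ~ W 0).
Hypothesis local_membership : forall e, (e0 <= e)%N ->
  exists2 w, W w & frob_pow I (p ^ e) (w * (c0 * x ^+ (p ^ e))).

(** The factor from [W] stands inside the q-th power, matching the w^q of [power_saturation]. *)
Definition witnesses (cw : D * D) (k : D) :=
  forall e, (e0 <= e)%N -> frob_pow I (p ^ e) (cw.1 * (cw.2 * k * x) ^+ (p ^ e)).

Definition admissible (cw : D * D) := cw.1 != 0 /\ W cw.2.

Definition multipliers (k : D) := exists2 cw, admissible cw & witnesses cw k.

Let ideal_frob e : is_ideal (frob_pow I (p ^ e)). Proof. exact: gen_ideal. Qed.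

Let expn_gt0 e : (0 < p ^ e)%N.
Proof. by rewrite expn_gt0 (prime.prime_gt0 (pcharf_prime pcharD)). Qed.

Lemma witnesses_ideal cw : is_ideal (witnesses cw).
Proof.
split.
- move=> e _; rewrite mulr0 mul0r expr0n -[_ == 0]negbK -lt0n expn_gt0 mulr0.
  exact: (ideal0 (ideal_frob e)).
- move=> k l hk hl e he; rewrite mulrDr mulrDl (frobeniusD pcharD) mulrDr.
  by apply: (idealD (ideal_frob e)); [exact: hk | exact: hl].
- move=> r k hk e he; rewrite [_ * (r * k)]mulrCA -[r * _ * x]mulrA exprMn mulrCA.
  exact/(idealZl _ (ideal_frob e))/hk.
Qed.

Lemma witnesses_directed cw dv : admissible cw -> admissible dv ->
  exists u, [/\ admissible u, subset (witnesses cw) (witnesses u) &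
                subset (witnesses dv) (witnesses u)].
Proof.
case: cw dv => [c w] [d v] [/= c00 Ww] [/= d00 Wv].
exists (c * d, w * v); split; first by split; [exact: mulf_neq0 | exact: WM].
  move=> k hk e he /=; rewrite [X in frob_pow _ _ X](_ : _ =
    d * v ^+ (p ^ e) * (c * (w * k * x) ^+ (p ^ e))); last by rewrite !exprMn; ring.
  exact/(idealZl _ (ideal_frob e))/hk.
move=> k hk e he /=; rewrite [X in frob_pow _ _ X](_ : _ =
  c * w ^+ (p ^ e) * (d * (v * k * x) ^+ (p ^ e))); last by rewrite !exprMn; ring.
exact/(idealZl _ (ideal_frob e))/hk.
Qed.

Lemma multipliers_ideal : is_ideal multipliers.
Proof.
split.
- by exists (1, 1); [split=> //; apply: oner_neq0 | exact: (ideal0 (witnesses_ideal _))].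
- move=> k l [cw acw hk] [dv adv hl].
  have [u [au cu du]] := witnesses_directed acw adv.
  by exists u => //; apply: (idealD (witnesses_ideal u)); [exact: cu | exact: du].
- by move=> r k [cw acw hk]; exists cw => //; apply: (idealZl _ (witnesses_ideal cw)).
Qed.

Lemma multipliers_saturated v k : W v -> multipliers (v * k) -> multipliers k.
Proof.
move=> Wv [[c w] [c00 Ww] hk]; exists (c, w * v).
  by split=> //; apply: WM.
by move=> e he /=; rewrite -[w * v * k]mulrA; apply: hk.
Qed.

(** A fixed [c] sends k^q I^[q] into (f^q), so v c c0 (k x)^q lies in (f^q). Here [v] depends on q;
    [power_saturation] replaces it by w^q. *)
Lemma principal_reduction_multiplier f k : I f -> f != 0 ->
  (forall a, I a -> principal_closure p f (k * a)) -> multipliers k.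
Proof.
move=> If f0 hk.
have [||||c c00 hc] := noeth_directed noethD (I := I) (D := fun c => c != 0)
  (Phi := fun c a => forall e, exists r, c * (k * a) ^+ (p ^ e) = r * f ^+ (p ^ e)).
- by exists 1; apply: oner_neq0.
- move=> c c00; split.
  + by move=> e; exists 0; rewrite mulr0 expr0n -[_ == 0]negbK -lt0n expn_gt0 mulr0 mul0r.
  + move=> a b ha hb e; have [r er] := ha e; have [s es] := hb e; exists (r + s).
    by rewrite mulrDr (frobeniusD pcharD) mulrDr er es mulrDl.
  + move=> s a ha e; have [r er] := ha e; exists (s ^+ (p ^ e) * r).
    by rewrite mulrCA exprMn mulrCA er mulrA.
- move=> c d c00 d00; exists (c * d); split; first exact: mulf_neq0.
    move=> a ha e; have [r er] := ha e; exists (d * r).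
    by rewrite [c * d]mulrC -!mulrA er.
  by move=> a ha e; have [r er] := ha e; exists (c * r); rewrite -!mulrA er.
- by move=> a /hk[c c00 hc]; exists c.
have [w Ww hw] := power_saturation f0.
exists (c * c0, w); first by split=> //; apply: mulf_neq0.
move=> e /local_membership[v Wv hv] /=.
have [r er] : exists r, c * k ^+ (p ^ e) * (v * (c0 * x ^+ (p ^ e))) = r * f ^+ (p ^ e).
  pose J z := exists r, c * k ^+ (p ^ e) * z = r * f ^+ (p ^ e).
  suff /(_ _ hv) : subset (frob_pow I (p ^ e)) J by [].
  apply: gen_min; first split.
  - by exists 0; rewrite mulr0 mul0r.
  - by move=> y z [r er] [s es]; exists (r + s); rewrite mulrDr er es mulrDl.
  - by move=> s y [r er]; exists (s * r); rewrite mulrCA er mulrA.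
  - move=> _ [a Ia ->]; have [r er] := hc a Ia e.
    by exists r; rewrite -er exprMn mulrA.
have [|s es] := hw (p ^ e)%N (c * c0 * (k * x) ^+ (p ^ e)) v r Wv.
  by rewrite -er exprMn; ring.
rewrite -[w * k * x]mulrA exprMn mulrCA es.
by apply: (idealZl _ (ideal_frob e)); apply: frob_powX.
Qed.

(** Otherwise some prime [M] contains [v] and all multipliers. By saturation it can be shrunk to a
    prime [Q] over the multipliers that misses [v]; yet a multiplier is found outside [Q]. *)
Lemma multipliers_comaximal : (exists2 a, I a & a != 0) ->
  forall v, W v -> adjoin multipliers v 1.
Proof.
move=> [a Ia a0] v Wv; have hK := multipliers_ideal.
apply: contrapT => nadj.
have [|||M [pM KM dM]] := @prime_exists _ noethD (adjoin multipliers v) (fun y => y = 1).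
- exact: adjoin_ideal.
- by split=> // y z -> ->; rewrite mulr1.
- by move=> _ ->.
have {}KM : subset multipliers M /\ M v.
  by split=> [k /(adjoin_sub v)/KM //|]; apply/KM/adjoin_mem.
case: KM => KM Mv; have [hM M1 _] := pM.
(* Avoiding every s v^n with [s] outside [M] forces [Q] into [M] and [v] out of [Q]. *)
have [|||Q [pQ KQ dQ]] := @prime_exists _ noethD multipliers
  (fun y => exists s n, ~ M s /\ y = s * v ^+ n).
- exact: hK.
- split; first by exists 1, 0%N; rewrite expr0 mulr1.
  move=> _ _ [s [n [Ms ->]]] [s' [n' [Ms' ->]]]; exists (s * s'), (n + n')%N.
  by split; [exact: primeNM | rewrite exprD mulrACA].
- move=> _ [s [n [Ms ->]]]; rewrite mulrC.
  by move=> /(multipliers_saturated (mult_systemX n multW Wv))/KM.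
have Qv : ~ Q v by apply: dQ; exists 1, 1%N; rewrite mul1r expr1.
have QM : subset Q M.
  move=> y Qy; apply: contrapT => My; apply: (dQ y) => //.
  by exists y, 0%N; rewrite expr0 mulr1.
have [hQ Q1 _] := pQ.
have adjQ : ~ adjoin Q v 1.
  move=> [s [u [Qs e1]]]; apply: M1; rewrite e1; apply: idealD => //.
    exact: QM.
  exact: idealZl.
(* An [f] in [I] outside [Q] is itself a multiplier: take k = f, since f b is in (f) for every
   [b]. *)
have [IQ|/existsNP[f /not_implyP[If Qf]]] := EM (subset I Q); last first.
  apply/Qf/KQ/(principal_reduction_multiplier If).
    by apply/eqP => f0; apply: Qf; rewrite f0; apply: ideal0.
  by move=> b _; rewrite mulrC; apply: principal_closure_mul.
have minQ P : is_prime P -> subset P Q -> ~ subset Q P -> forall z, P z -> z = 0.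
  move=> pP PQ QP z Pz; apply: contrapT => z0; apply: dimD.
  (* A nonzero prime [P] strictly inside [Q] would give a chain 0, P, Q, M of length three; [v]
     separates [Q] from [M]. *)
  exists (fun i => match i with 0 => fun y => y = 0 | 1 => P | 2 => Q | _ => M end).
  split=> [[|[|[|i]]] _ //|[|[|[|i]]] //= _].
  - split; first exact: zero_ideal.
      by apply/eqP/oner_neq0.
    by move=> y y' /eqP; rewrite mulf_eq0 => /orP[]/eqP; [left|right].
  - split; last by move/(_ z Pz).
    by move=> _ ->; case: pP => hP _ _; apply: ideal0.
  - by split=> // /(_ v Mv).
have [|f [k [If f0 Qk hk]]] :=
  principal_reduction noethD pQ minQ pcharD Qv adjQ idealI; first by exists a.
exact/Qk/KQ/(principal_reduction_multiplier If f0).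
Qed.

Lemma domain_case : exists c w, [/\ c != 0, W w &
  forall e, (e0 <= e)%N -> frob_pow I (p ^ e) (c * (w * x) ^+ (p ^ e))].
Proof.
(* If I = 0, local membership in a domain forces x = 0. *)
have [nzI|zI] := EM (exists2 a, I a & a != 0); last first.
  have [w Ww hw] := local_membership (leqnn e0).
  suff x0 : x = 0.
    exists 1, 1; split=> [||e _]; [exact: oner_neq0 | by [] |].
    rewrite x0 mulr0 expr0n -[_ == 0]negbK -lt0n expn_gt0 mulr0.
    exact: (ideal0 (ideal_frob e)).
  have : w * (c0 * x ^+ (p ^ e0)) = 0.
    apply: (gen_min (@zero_ideal D) _ hw).
    move=> _ [a Ia ->]; have [->|a0] := eqVneq a 0; last by case: zI; exists a.
    by rewrite expr0n -[_ == 0]negbK -lt0n expn_gt0.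
  move/eqP; rewrite !mulf_eq0 (negPf c0N0) expf_eq0 expn_gt0 /=.
  by case/orP=> /eqP // w0; case: WN0; rewrite -w0.
have hK := multipliers_ideal.
(* One pair serves all multipliers, which matters because the [k] used below varies with [e]. *)
have [||[c w] [c00 Ww] hcw] := noeth_directed noethD (I := multipliers)
    (D := admissible) (Phi := witnesses) _ (fun cw _ => witnesses_ideal cw)
    witnesses_directed.
- by exists (1, 1); split=> //; apply: oner_neq0.
- by [].
exists (c * c0), w; split=> //; first exact: mulf_neq0.
move=> e he; have [v Wv hv] := local_membership he.
have [k [u [Kk e1]]] := multipliers_comaximal nzI Wv.
(* The left side is multiplied by the q-th power of 1 = k + u v: the [k] part falls under [hcw], the
   other is a multiple of v c0 x^q. *)
rewrite [X in frob_pow _ _ X](_ : _ =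
    c0 * (c * (w * k * x) ^+ (p ^ e)) +
    c * w ^+ (p ^ e) * u ^+ (p ^ e) * v ^+ (p ^ e).-1 * (v * (c0 * x ^+ (p ^ e)))).
  apply: (idealD (ideal_frob e)); last exact: idealZl.
  by apply/(idealZl _ (ideal_frob e))/hcw.
have eqv : v ^+ (p ^ e) = v ^+ (p ^ e).-1 * v by rewrite -exprSr prednK.
have eq1 : 1 = k ^+ (p ^ e) + u ^+ (p ^ e) * (v ^+ (p ^ e).-1 * v).
  by rewrite -eqv -exprMn -(frobeniusD pcharD) -e1 expr1n.
by rewrite -[LHS]mulr1 [X in _ * X]eq1 !exprMn; ring.
Qed.

End Domain.

(** * Reduction to domains *)

Lemma noetherian_image (R S : comPzRingType) (pi : {rmorphism R -> S}) :
  (forall d, exists r, pi r = d) -> noetherian R -> noetherian S.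
Proof.
move=> pi_surj noethR C hC incC.
have [|n|n hn] := @noethR (fun n r => C n (pi r)).
- move=> n; split; first by rewrite rmorph0; apply: (ideal0 (hC n)).
  + by move=> x y Cx Cy; rewrite rmorphD; apply: (idealD (hC n)).
  + by move=> r x Cx; rewrite rmorphM; apply: (idealZl _ (hC n)).
- by move=> r /incC.
exists n => m nm d; have [r <-] := pi_surj d; exact: hn.
Qed.

Lemma dim_lt_image (R S : comPzRingType) (pi : {rmorphism R -> S}) n :
  (forall d, exists r, pi r = d) -> dim_lt R n -> dim_lt S n.
Proof.
move=> pi_surj dimR [P [pP incP]]; apply: dimR; exists (fun i r => P i (pi r)).
split=> i hi; first exact/prime_pullback/pP.
have [sP nP] := incP i hi; split=> [r /sP//|nP']; apply: nP => d.
by have [r <-] := pi_surj d; apply: nP'.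
Qed.

Lemma dim_ltS (R : comPzRingType) n : dim_lt R n -> dim_lt R n.+1.
Proof.
move=> dimR [P [pP incP]]; apply: dimR; exists P.
by split=> i hi; [apply/pP/leqW | apply/incP/leqW].
Qed.

Lemma img_ideal (R S : comPzRingType) (pi : {rmorphism R -> S}) (I : R -> Prop) :
  (forall d, exists r, pi r = d) -> is_ideal I -> is_ideal (img pi I).
Proof.
move=> pi_surj hI; split.
- by exists 0; [exact: ideal0 | rewrite rmorph0].
- by move=> _ _ [x Ix ->] [y Iy ->]; exists (x + y); [exact: idealD | rewrite rmorphD].
- move=> s _ [x Ix ->]; have [r <-] := pi_surj s.
  by exists (r * x); [exact: idealZl | rewrite rmorphM].
Qed.

(** * Gluing multipliers over the minimal primes *)

Section TightClosure.
Variables (R : comNzRingType) (p : nat).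
Hypotheses (noethR : noetherian R) (pcharR : p \in [pchar R]).
Implicit Types (I P : R -> Prop).

Let frob_ideal I e : is_ideal (frob_pow I (p ^ e)). Proof. exact: gen_ideal. Qed.

Let p_gt1 : (1 < p)%N. Proof. exact: prime.prime_gt1 (pcharf_prime pcharR). Qed.

Let q_gt0 e : (0 < p ^ e)%N. Proof. by rewrite expn_gt0 ltnW. Qed.

Let zeroX e : 0 ^+ (p ^ e) = 0 :> R.
Proof. by rewrite expr0n -[_ == 0]negbK -lt0n q_gt0. Qed.

Lemma circM (c d : R) : circ c -> circ d -> circ (c * d).
Proof. by move=> hc hd P mP; apply: (primeNM mP.1); [exact: hc | exact: hd]. Qed.

Lemma tight_closure_ideal I : is_ideal (tight_closure p I).
Proof.
split.
- exists 1; first by move=> P [[]].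
  by exists 0%N => e _; rewrite zeroX mulr0; apply: (ideal0 (frob_ideal I e)).
- move=> x y [c hc [e0 cx]] [d hd [e1 dy]]; exists (c * d); first exact: circM.
  exists (maxn e0 e1) => e; rewrite geq_max => /andP[he0 he1].
  rewrite (frobeniusD pcharR) mulrDr; apply: (idealD (frob_ideal I e)).
    by rewrite -mulrA mulrCA; apply/(idealZl _ (frob_ideal I e))/cx.
  by rewrite -mulrA; apply/(idealZl _ (frob_ideal I e))/dy.
- move=> r x [c hc [e0 cx]]; exists c => //; exists e0 => e he.
  by rewrite exprMn mulrCA; apply/(idealZl _ (frob_ideal I e))/cx.
Qed.

Lemma frob_powXX I e e' y :
  frob_pow I (p ^ e) y -> frob_pow I (p ^ (e + e')) (y ^+ (p ^ e')).
Proof.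
move: y; apply: gen_min; first split.
- by rewrite zeroX; apply: (ideal0 (frob_ideal I _)).
- move=> y z hy hz; rewrite (frobeniusD pcharR).
  exact: (idealD (frob_ideal I _)).
- by move=> r y hy; rewrite exprMn; apply: (idealZl _ (frob_ideal I _)).
- move=> _ [a Ia ->]; rewrite -exprM -expnD; exact: frob_powX.
Qed.

(** Since P R_P is the only prime of R_P, each [t] in [P] has a power killed by some [d] outside
    [P]. Frobenius is additive, so a fixed pair works for an ideal of [t], and by directedness one
    pair works for all of [P]. *)
Lemma minimal_prime_nilpotent P : is_minimal_prime P ->
  exists d e, ~ P d /\ forall t, P t -> d * t ^+ (p ^ e) = 0.
Proof.
move=> [pP minP]; have [hP P1 _] := pP.
have [||||[d e] Pd h] := noeth_directed noethR (I := P)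
  (D := fun de : R * nat => ~ P de.1)
  (Phi := fun de t => de.1 * t ^+ (p ^ de.2) = 0); last by exists d, e.
- by exists (1, 0%N).
- move=> [d e] _ /=; split; first by rewrite zeroX mulr0.
    by move=> x y hx hy; rewrite (frobeniusD pcharR) mulrDr hx hy addr0.
  by move=> r x hx; rewrite exprMn mulrCA hx mulr0.
- move=> [d e] [d' e'] /= Pd Pd'; exists (d * d', maxn e e') => /=.
  have le_pow k : (k <= maxn e e')%N -> (p ^ k <= p ^ maxn e e')%N.
    by move=> hk; rewrite leq_exp2l.
  split; first exact: primeNM.
    move=> t ht; rewrite -(subnK (le_pow _ (leq_maxl e e'))) exprD.
    set m := (_ - _)%N; transitivity (d' * t ^+ m * (d * t ^+ (p ^ e))); first by ring.
    by rewrite ht mulr0.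
  move=> t ht; rewrite -(subnK (le_pow _ (leq_maxr e e'))) exprD.
  set m := (_ - _)%N; transitivity (d * t ^+ m * (d' * t ^+ (p ^ e'))); first by ring.
  by rewrite ht mulr0.
- move=> t Pt; apply: contrapT => hno.
  (* A prime missing all s t^n with [s] outside [P] lies in [P] and misses [t], against
     minimality. *)
  have [|||Q [pQ _ dQ]] := @prime_exists _ noethR (fun x => x = 0)
      (fun y => exists s n, ~ P s /\ y = s * t ^+ n).
  + exact: zero_ideal.
  + split; first by exists 1, 0%N; rewrite expr0 mulr1.
    move=> _ _ [s [n [Ps ->]]] [s' [n' [Ps' ->]]]; exists (s * s'), (n + n')%N.
    by split; [exact: primeNM | rewrite exprD mulrACA].
  + move=> _ [s [n [Ps ->]]] st0; apply: hno; exists (s, n) => //=.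
    have np : (n <= p ^ n)%N by rewrite ltnW // ltn_expl.
    by rewrite -(subnK np) exprD mulrCA st0 mulr0.
  apply: (dQ t); first by exists 1, 1%N; rewrite mul1r expr1.
  apply: minP Pt => // y Qy; apply: contrapT => Py; apply: (dQ y) => //.
  by exists y, 0%N; rewrite expr0 mulr1.
Qed.

Section Multiplier.
Variables (I W : R -> Prop) (x c0 : R) (e0 : nat).
Hypotheses (idealI : is_ideal I) (multW : mult_system W) (dimR : dim_lt R 3).
Hypothesis local_membership : forall e, (e0 <= e)%N ->
  exists2 w, W w & frob_pow I (p ^ e) (w * (c0 * x ^+ (p ^ e))).
Hypothesis c0_circ : forall P, is_minimal_prime P ->
  (forall w, W w -> ~ P w) -> ~ P c0.

Let W1 : W 1. Proof. by case: multW. Qed.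
Let WM v w : W v -> W w -> W (v * w). Proof. by case: multW => _; apply. Qed.

Lemma modulo_minimal_prime P : is_minimal_prime P -> exists c w,
  [/\ ~ P c, W w & forall e, (e0 <= e)%N ->
    exists2 y, frob_pow I (p ^ e) y & P (c * (w * x) ^+ (p ^ e) - y)].
Proof.
move=> mP; have pP := mP.1; have [hP P1 _] := pP.
have [[w [Ww Pw]]|dWP] := EM (exists w, W w /\ P w).
  (* When [w] itself lies in [P], so does (w x)^q. *)
  exists 1, w; split=> // e _; exists 0; first exact: (ideal0 (frob_ideal I e)).
  rewrite subr0 mul1r exprMn -(prednK (q_gt0 e)) exprS -mulrA.
  exact: idealZr.
have {}dWP w : W w -> ~ P w by move=> Ww Pw; apply: dWP; exists w.
have [D [pi [pi_surj piP]]] := prime_quotient pP.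
have frob_img e y : frob_pow I (p ^ e) y -> frob_pow (img pi I) (p ^ e) (pi y).
  move: y; apply: gen_min; first split.
  - by rewrite rmorph0; apply: (ideal0 (gen_ideal _)).
  - by move=> y z hy hz; rewrite rmorphD; apply: (idealD (gen_ideal _)).
  - by move=> r y hy; rewrite rmorphM; apply: (idealZl _ (gen_ideal _)).
  - by move=> _ [a Ia ->]; rewrite rmorphXn; apply: frob_powX; exists a.
have frob_lift e z : frob_pow (img pi I) (p ^ e) z ->
    exists2 y, frob_pow I (p ^ e) y & pi y = z.
  move=> hz; suff [y hy ->] : img pi (frob_pow I (p ^ e)) z by exists y.
  apply: gen_min hz; first exact: (img_ideal pi_surj (frob_ideal I e)).
  by move=> _ [_ [a Ia ->] ->]; exists (a ^+ (p ^ e)); [exact: frob_powX | rewrite rmorphXn].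
have [||||||||c [w [c00 [w' Ww' ->{w}] hcw]]] := @domain_case D p (img pi W) (img pi I)
  _ _ _ _ (pi x) (pi c0) e0.
- exact: noetherian_image pi_surj noethR.
- exact: rmorph_pchar pcharR.
- exact: img_ideal.
- split; first by exists 1; rewrite ?rmorph1.
  move=> _ _ [v Wv ->] [w Ww ->]; exists (v * w); [exact: WM | by rewrite rmorphM].
- by apply/eqP => /piP; apply: c0_circ.
- exact: dim_lt_image pi_surj dimR.
- by move=> [w Ww /esym/piP]; apply: dWP.
- move=> e /local_membership[w Ww hw]; exists (pi w); first by exists w.
  by rewrite -rmorphXn -!rmorphM; apply: frob_img.
have [c' ec] := pi_surj c; exists c', w'; split=> //.
  by move=> /piP c'0; rewrite -ec c'0 eqxx in c00.
move=> e /hcw/frob_lift[y hy ey]; exists y => //.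
by apply/piP; rewrite rmorphB ey -ec !(rmorphM, rmorphXn) subrr.
Qed.

(** The [c] that work with some [w] in [W] form an ideal [C] contained in no minimal prime, so prime
    avoidance yields one outside all minimal primes. *)
Lemma tight_closure_multiple : exists2 w, W w & tight_closure p I (w * x).
Proof.
pose C c := exists2 w, W w & exists e1, forall e, (e1 <= e)%N ->
  frob_pow I (p ^ e) (c * (w * x) ^+ (p ^ e)).
have hC : is_ideal C.
  split.
  - by exists 1 => //; exists 0%N => e _; rewrite mul0r; apply: (ideal0 (frob_ideal I e)).
  - move=> c d [v Wv [e1 hc]] [w Ww [e2 hd]]; exists (v * w); first exact: WM.
    exists (maxn e1 e2) => e; rewrite geq_max => /andP[he1 he2].
    rewrite mulrDl; apply: (idealD (frob_ideal I e)).
      rewrite [v * w]mulrC -mulrA exprMn mulrCA.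
      exact/(idealZl _ (frob_ideal I e))/hc.
    rewrite -mulrA exprMn mulrCA.
    exact/(idealZl _ (frob_ideal I e))/hd.
  - move=> r c [w Ww [e1 hc]]; exists w => //; exists e1 => e he.
    by rewrite -mulrA; apply/(idealZl _ (frob_ideal I e))/hc.
have CP P : is_minimal_prime P -> ~ subset C P.
  move=> mP CP; have [c [w [Pc Ww hc]]] := modulo_minimal_prime mP.
  have [d [e' [Pd hd]]] := minimal_prime_nilpotent mP.
  (* The relation modulo [P] is raised to the power p^e' and multiplied by [d], which kills the
     error term in [P]. *)
  apply: (primeNM mP.1 Pd (y := c ^+ (p ^ e'))) => [/(primeX mP.1)//|].
  apply: CP; exists w => //; exists (e0 + e')%N => e he.
  have e'e : (e' <= e)%N := leq_trans (leq_addl _ _) he.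
  have [|y hy /hd] := hc (e - e')%N; first by rewrite leq_subRL // addnC.
  rewrite -[_ - y]/(_ + _) (frobeniusD pcharR) mulrDr.
  have -> : d * (c * (w * x) ^+ (p ^ (e - e'))) ^+ (p ^ e') =
      d * c ^+ (p ^ e') * (w * x) ^+ (p ^ e).
    by rewrite exprMn -exprM -expnD subnK // mulrA.
  move=> /eqP; rewrite addr_eq0 => /eqP ->; rewrite -mulNr.
  apply/(idealZl _ (frob_ideal I e)); rewrite -(subnK e'e); apply: frob_powXX.
  by rewrite -mulN1r; apply: (idealZl _ (frob_ideal I _)).
have [L [pL Lmin]] := finite_primes noethR.
(* Only listed primes not containing [C] can be avoided; every minimal prime equals one of these. *)
have [||c Cc cL] := @prime_avoidance _ (List.filter (fun P => `[<~ subset C P>]) L) C hC.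
- by move=> P /List.filter_In[/pL].
- by move=> P /List.filter_In[_ /asboolP].
have [w Ww hw] := Cc; exists w => //; exists c => // Q mQ Qc.
have [P LP PQ] := Lmin Q mQ.1.
have QP := mQ.2 P (pL P LP) PQ.
apply: (cL P); last exact: QP.
apply/List.filter_In; split=> //; apply/asboolP => sCP.
by apply: (CP Q mQ) => y /sCP/PQ.
Qed.

End Multiplier.
End TightClosure.

(** * Localization *)

Section Localization.
Variables (R S : comPzRingType) (W : R -> Prop) (f : {rmorphism R -> S}).
Hypotheses (multW : mult_system W) (locf : is_localization W f).
Implicit Types (J P : R -> Prop).

Let W1 : W 1. Proof. by case: multW. Qed.
Let WM v w : W v -> W w -> W (v * w). Proof. by case: multW => _; apply. Qed.

Lemma loc_unit w : W w -> exists v, f w * v = 1.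
Proof. by case: locf => + _ _; apply. Qed.

Lemma loc_frac s : exists r w, W w /\ s * f w = f r.
Proof. by case: locf. Qed.

Lemma loc_eq r r' : f r = f r' -> exists2 w, W w & w * r = w * r'.
Proof.
move=> e; have [_ _ h] := locf; have [|w Ww] := h (r - r').
  by rewrite rmorphB e subrr.
by rewrite mulrBr => /eqP; rewrite subr_eq0 => /eqP; exists w.
Qed.

Lemma loc_cancel w (Q : S -> Prop) s : is_ideal Q -> W w -> Q (s * f w) -> Q s.
Proof.
move=> hQ Ww; have [v fv] := loc_unit Ww => /(idealZr v hQ).
by rewrite -mulrA fv mulr1.
Qed.

Lemma prime_disjoint (Q : S -> Prop) w : is_prime Q -> W w -> ~ Q (f w).
Proof.
move=> [hQ Q1 _] Ww Qw; apply/Q1/(loc_cancel hQ Ww).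
by rewrite mul1r.
Qed.

(** The ideal J S, each element being a single fraction with numerator in [J]. *)
Definition extension J (s : S) := exists w r, [/\ W w, J r & s * f w = f r].

Lemma extension_ideal J : is_ideal J -> is_ideal (extension J).
Proof.
move=> hJ; split.
- by exists 1, 0; split=> //; [exact: ideal0 | rewrite rmorph0 mul0r].
- move=> s s' [w [r [Ww Jr e]]] [w' [r' [Ww' Jr' e']]].
  exists (w * w'), (r * w' + r' * w); split; first exact: WM.
    by apply: idealD => //; apply: idealZr.
  by rewrite rmorphD !rmorphM -e -e'; ring.
- move=> s' s [w [r [Ww Jr e]]]; have [r' [w' [Ww' e']]] := loc_frac s'.
  exists (w' * w), (r' * r); split; [exact: WM | exact: idealZl |].
  by rewrite !rmorphM mulrACA e e'.
Qed.

Lemma gen_img_extension J : is_ideal J -> subset (gen (img f J)) (extension J).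
Proof.
move=> hJ; apply: gen_min; first exact: extension_ideal.
by move=> _ [a Ja ->]; exists 1, a; split=> //; rewrite rmorph1 mulr1.
Qed.

Lemma frob_pow_extension J q : is_ideal J ->
  subset (frob_pow (gen (img f J)) q) (extension (frob_pow J q)).
Proof.
move=> hJ; apply: gen_min; first exact/extension_ideal/gen_ideal.
move=> _ [y /(gen_img_extension hJ)[w [a [Ww Ja e]]] ->].
exists (w ^+ q), (a ^+ q); split; [exact: mult_systemX | exact: frob_powX |].
by rewrite !rmorphXn -exprMn e.
Qed.

Lemma frob_pow_img J q r : frob_pow J q r -> frob_pow (gen (img f J)) q (f r).
Proof.
move: r; apply: gen_min; first split.
- by rewrite rmorph0; apply: (ideal0 (gen_ideal _)).
- by move=> y z hy hz; rewrite rmorphD; apply: (idealD (gen_ideal _)).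
- by move=> r y hy; rewrite rmorphM; apply: (idealZl _ (gen_ideal _)).
- move=> _ [a Ja ->]; rewrite rmorphXn; apply: frob_powX.
  by apply: gen_incl; exists a.
Qed.

Section PrimeExtension.
Variable P : R -> Prop.
Hypotheses (pP : is_prime P) (dWP : forall w, W w -> ~ P w).

Lemma extensionE r : extension P (f r) <-> P r.
Proof.
have [hP _ PM] := pP.
split=> [[w [a [Ww Pa]]]|Pr]; last by exists 1, r; split=> //; rewrite rmorph1 mulr1.
rewrite -rmorphM => /loc_eq[w' Ww' e].
have /PM[/(dWP Ww')//|/PM[//|/(dWP Ww)//]] : P (w' * (r * w)).
by rewrite e; apply: idealZl.
Qed.

Lemma extension_prime : is_prime (extension P).
Proof.
have [hP P1 PM] := pP; have hE := extension_ideal hP; split=> //.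
  by rewrite -(rmorph1 f) => /extensionE.
move=> s s' ss'; have [r [w [Ww e]]] := loc_frac s.
have [r' [w' [Ww' e']]] := loc_frac s'.
have /extensionE/PM[Pr|Pr'] : extension P (f (r * r')).
- by rewrite rmorphM -e -e' mulrACA; apply: (idealZr _ hE).
- by left; exists w, r.
- by right; exists w', r'.
Qed.

Lemma extension_sub (Q : S -> Prop) : is_ideal Q ->
  subset P (fun r => Q (f r)) -> subset (extension P) Q.
Proof. by move=> hQ PQ s [w [r [Ww /PQ Qr e]]]; apply: (loc_cancel hQ Ww); rewrite e. Qed.

End PrimeExtension.

(** A prime inside the contraction misses [W], so it extends to a prime of S inside [Q], where
    minimality applies. *)
Lemma contraction_minimal (Q : S -> Prop) :
  is_minimal_prime Q -> is_minimal_prime (fun r => Q (f r)).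
Proof.
move=> [pQ minQ]; split; first exact: prime_pullback.
have [hQ _ _] := pQ.
move=> P pP PQ r Qr; have dWP w : W w -> ~ P w.
  by move=> Ww /PQ; apply: prime_disjoint.
apply/(extensionE pP dWP).
exact: (minQ _ (extension_prime pP dWP) (extension_sub hQ PQ) _ Qr).
Qed.

Lemma extension_minimal P : is_minimal_prime P -> (forall w, W w -> ~ P w) ->
  is_minimal_prime (extension P).
Proof.
move=> [pP minP] dWP; split; first exact: extension_prime.
move=> Q pQ QP; have [hQ _ _] := pQ; apply: (extension_sub hQ).
apply: minP => [|r /QP/(extensionE pP dWP)//]; exact: prime_pullback.
Qed.

Lemma circ_img c : circ c -> circ (f c).
Proof. by move=> hc Q /contraction_minimal/hc. Qed.

End Localization.

(** * Comparison of tight closure before and after localization *)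

Theorem theorem1p1 (R : comNzRingType) (p : nat) :
  noetherian R -> p \in [pchar R] ->
  [\/ dim_lt R 2,
      is_local R /\ dim_eq R 2 |
      dim_eq R 2 /\
        (nagata R \/ exists e' (c : R), weak_test_element p e' c)] ->
  forall I : R -> Prop, is_ideal I ->
  forall W : R -> Prop, mult_system W ->
  forall (S : comPzRingType) (f : {rmorphism R -> S}), is_localization W f ->
  forall s : S,
    gen (img (f : R -> S) (tight_closure p I)) s <-> tight_closure p (gen (img (f : R -> S) I)) s.
Proof.
move=> noethR pcharR dimR I hI W multW S f locf s.
(* In each case a strict chain of primes has at most three members. *)
have {}dimR : dim_lt R 3.
  by case: dimR => [/dim_ltS|[_ [_ ]]|[[_ ]]].
split.
  move=> /(gen_img_extension multW locf (tight_closure_ideal pcharR I)).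
  move=> [w [x [Ww [c hc [e0 hx]] esx]]].
  exists (f c); first exact: (circ_img multW locf).
  exists e0 => e /hx/(frob_pow_img f) hfx.
  apply: (loc_cancel locf (gen_ideal _) (mult_systemX (p ^ e) multW Ww)).
  by rewrite rmorphXn -mulrA -exprMn esx -rmorphXn -rmorphM.
move=> [c hc [e0 hs]].
(* The fractions [s] and [c] are replaced by numerators [x] and [c0], which differ from them by
   units of S. *)
have [x [w0 [Ww0 esx]]] := loc_frac locf s.
have [c0 [w1 [Ww1 ec]]] := loc_frac locf c.
have [|P mP dWP Pc0|w Ww hwx] :=
  @tight_closure_multiple R p noethR pcharR I W x c0 e0 hI multW dimR.
- move=> e /hs/(idealZr (f (w1 * w0 ^+ (p ^ e))) (gen_ideal _)) hse.
  have : frob_pow (gen (img f I)) (p ^ e) (f (c0 * x ^+ (p ^ e))).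
    suff <- : c * s ^+ (p ^ e) * f (w1 * w0 ^+ (p ^ e)) = f (c0 * x ^+ (p ^ e)) by [].
    by rewrite !rmorphM !rmorphXn -ec -esx exprMn mulrACA.
  move=> /(frob_pow_extension multW locf hI)[w [r [Ww hr]]].
  rewrite -rmorphM => /(loc_eq locf)[w' Ww' e'].
  exists (w' * w); first by apply: multW.2.
  by rewrite -mulrA [w * _]mulrC e'; apply: (idealZl _ (gen_ideal _)).
(* [c0] in [P] would put [c] in the extension of [P], a minimal prime of S. *)
- have mE := extension_minimal multW locf mP dWP.
  have [[hE _ _] _] := mE.
  apply: (hc _ mE); apply: (loc_cancel locf hE Ww1); rewrite ec.
  exact/(extensionE multW locf mP.1 dWP).
have Www0 : W (w * w0) by apply: multW.2.
apply: (loc_cancel locf (gen_ideal _) Www0); apply: gen_incl; exists (w * x) => //.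
by rewrite !rmorphM mulrCA esx.
Qed.
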